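(* Let $q\in\mathbb{C}$ with $0<|q|\le 1$, let $\alpha\in[0,\frac{\pi}{2})$, and let $A, B, X, Y \in M_n$ with $A \in \prod_{q,\alpha}^n$. Let $\phi$ be an Orlicz function and $\psi$ the complementary Orlicz function to $\phi$. Then (for either choice of sign, the same on both sides) \begin{align*} w_q(AXB \pm BYA) \leq {}& 2|q| \max \{ \| XB \|, \| BY \| \} \Bigg( \phi \left(\frac{1}{|q|}w_q(A)\right)+\psi \left(\frac{1}{|q|}w_q(A)\right)\\ &+\phi \left(\left( \frac{\sin(\alpha)}{|q|}+\frac{2\sqrt{1-|q|^2}}{|q|^2}\right)w_q(A) \right) + \psi \left( \left(\frac{\sin(\alpha)}{|q|}+\frac{2\sqrt{1-|q|^2}}{|q|^2}\right)w_q(A) \right)\Bigg)^{\frac{1}{2}}\\ &+\sqrt{1-|q|^2}\,\|AXB \pm BYA\|. \end{align*}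
   Context: $M_n$ is the algebra of $n\times n$ complex matrices acting on $\mathbb{C}^n$ with inner product $\langle x,y\rangle=y^*x$ and operator norm $\|\cdot\|$. For $|q|\le 1$, $W_q(A)=\{\langle Ax,y\rangle : x,y\in\mathbb{C}^n,\ \|x\|=\|y\|=1,\ \langle x,y\rangle=q\}$ and $w_q(A)=\sup\{|z|: z\in W_q(A)\}$; it is understood that $W_q(A)$ is nonempty, i.e. $n\ge 1$ if $|q|=1$ and $n\ge 2$ if $|q|<1$. For $\alpha\in[0,\frac{\pi}{2})$ let $S_\alpha=\{z\in\mathbb{C}:\Re z>0,\ |\Im z|\le\tan(\alpha)\,\Re z\}$; $\prod_{q,\alpha}^n$ denotes the set of $A\in M_n$ with $W_q(A)\subseteq S_\alpha$. An Orlicz function (non-degenerate) is a continuous, convex, increasing function $\phi:[0,\infty)\to[0,\infty)$ with $\phi(0)=0$, $\phi(t)>0$ for every $t>0$, and $\lim_{t\to\infty}\phi(t)=\infty$. When speaking of complementary functions, $\phi$ is represented as $\phi(t)=\int_0^t\gamma(u)\,du$ with kernel $\gamma$ non-decreasing, $\gamma(0)=0$, $\gamma(u)>0$ for $u>0$, $\lim_{u\to\infty}\gamma(u)=\infty$; the right inverse of $\gamma$ is $\eta(v)=\sup\{u:\gamma(u)\le v\}$, $v\ge 0$, and the complementary Orlicz function to $\phi$ is $\psi(s)=\int_0^s\eta(v)\,dv$. *)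

(* Defs.v *)
From HB Require Import structures.
From mathcomp Require Import all_boot all_order all_algebra.
From mathcomp Require Import all_classical all_reals all_analysis.
From mathcomp Require Import complex.
Set Implicit Arguments.
Unset Strict Implicit.
Unset Printing Implicit Defensive.
Import Order.TTheory GRing.Theory Num.Theory.
Import numFieldNormedType.Exports.
Local Open Scope classical_set_scope.
Local Open Scope ring_scope.

(* The norm `|z| of z : R[i] is itself an element of R[i]; the R-valued modulus
   used throughout is Normc.normc. *)
Notation cmod := (@Normc.normc _).

Section NumericalRange.
Variables (R : realType) (n : nat).
Local Notation C := R[i].

Definition inner (x y : 'cV[C]_n) : C := (map_mx conjc y^T *m x) 0 0.

Definition vnorm (x : 'cV[C]_n) : R := Num.sqrt (complex.Re (inner x x)).

Definition opnorm (A : 'M[C]_n) : R :=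
  sup [set r | exists2 x : 'cV[C]_n, vnorm x = 1 & r = vnorm (A *m x)].

Definition qrange (q : C) (A : 'M[C]_n) : set C :=
  [set z | exists x y : 'cV[C]_n,
    [/\ vnorm x = 1, vnorm y = 1, inner x y = q & z = inner (A *m x) y]].

Definition qradius (q : C) (A : 'M[C]_n) : R := sup (cmod @` qrange q A).

Definition sector (alpha : R) : set C :=
  [set z | 0 < complex.Re z /\ `|complex.Im z| <= tan alpha * complex.Re z].

Definition qsectorial (q : C) (alpha : R) (A : 'M[C]_n) : Prop :=
  qrange q A `<=` sector alpha.

End NumericalRange.

(* Functions on [0, oo) are represented by functions R -> R all of whose
   properties are required on `[0, +oo[ only. *)
Section Orlicz.
Variable R : realType.
Local Notation mu := (@lebesgue_measure R).

Definition orlicz (phi : R -> R) : Prop :=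
  [/\ {within `[0, +oo[, continuous phi},
      convex_function (E := R^o) `[0, +oo[ phi,
      {in `[0, +oo[ &, {homo phi : s t / s < t}},
      phi 0 = 0 /\ (forall t : R, 0 < t -> 0 < phi t)
    & phi t @[t --> +oo] --> +oo].

Definition orlicz_kernel (gamma : R -> R) : Prop :=
  [/\ {in `[0, +oo[ &, {homo gamma : u v / u <= v}},
      gamma 0 = 0,
      forall u : R, 0 < u -> 0 < gamma u
    & gamma u @[u --> +oo] --> +oo].

Definition kernel_rinv (gamma : R -> R) (v : R) : R :=
  sup [set u | 0 <= u /\ gamma u <= v].

Definition primitive_of (f g : R -> R) : Prop :=
  forall t : R, 0 <= t -> (f t)%:E = (\int[mu]_(u in `[0%R, t]) (g u)%:E)%E.

(* The kernel is determined by phi only up to its values at jump points, which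
   do not affect psi; hence the existential. *)
Definition complementary (phi psi : R -> R) : Prop :=
  exists gamma : R -> R,
    [/\ orlicz_kernel gamma, primitive_of phi gamma
      & primitive_of psi (kernel_rinv gamma)].

End Orlicz.

(* Main.v *)
Require Import Defs.
From HB Require Import structures.
From mathcomp Require Import all_boot all_order all_algebra.
From mathcomp Require Import all_classical all_reals all_analysis.
From mathcomp Require Import complex.
From mathcomp Require Import measurable_realfun ring lra.
Set Implicit Arguments.
Unset Strict Implicit.
Unset Printing Implicit Defensive.
Import Order.TTheory GRing.Theory Num.Theory.
Import numFieldNormedType.Exports.
Local Open Scope classical_set_scope.
Local Open Scope ring_scope.

(** Write [s = sqrt (1 - |q|^2)], [w = w_q(A)], [T = AXB +- BYA] and
    [M = max (||XB||, ||BY||)].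

    The Orlicz functions enter only through Young's inequality
    [a * b <= phi a + psi b] ([young_complementary]): the rectangle
    [[0, a] x [0, b]] is covered by the region under the graph of the kernel
    [gamma] and the region under the graph of its right inverse, turned by a
    quarter. Applied to [(a, a)] and [(b, b)], it leaves the estimate
    [w_q(T) <= 2 |q| M sqrt (a^2 + b^2) + s ||T||] to be proved.

    If [x] and [y] are unit vectors with [<x, y> = q], then
    [y = conj(q) x + z] with [z] orthogonal to [x] of norm [s], so
    [w_q(T) <= |q| w(T) + s ||T||] with [w(T)] the numerical radius
    ([qradius_le]). Moving [A] to the right factor by adjunction,
    [|<T x, x>| <= M (||A x|| + ||A^* x||)]
    ([inner_generalized_commutator_le]).

    Conversely [conj(q) x + z] and [conj(q) x - z] are both admissible
    partners of [x] ([q_companions]), and summing the corresponding two points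
    of the q-numerical range gives [2 q <A x, x>]. Hence [|q <A x, x>| <= w]
    and, the sector being a convex cone, [q <A x, x>] lies in it, so that its
    imaginary part is at most [sin alpha * w] in modulus.

    With [u = q / |q|], the Hermitian and skew-Hermitian parts [H] and [K] of
    [u A] therefore have numerical radii at most [a] and [b], which for
    Hermitian matrices are their norms ([hermitian_vnorm_le]). The
    parallelogram identity
    [||A x||^2 + ||A^* x||^2 = 2 (||H x||^2 + ||K x||^2)] then yields
    [||A x|| + ||A^* x|| <= 2 sqrt (a^2 + b^2)] ([cartesian_vnorm_le]). *)

(** * Young's inequality for complementary Orlicz functions *)

Section Young.
Variable R : realType.
Local Notation mu := (@lebesgue_measure R).

(** The base coordinate [f] and the height [p] are left abstract so that both
    the region under a graph and its transpose are instances. *)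
Lemma measurable_undergraph d d' (S : measurableType d) (T : measurableType d')
    (D : set T) (p : S -> R) (f : S -> T) (g : T -> R) :
  measurable D -> measurable_fun D g ->
  measurable_fun setT p -> measurable_fun setT f ->
  measurable [set z | D (f z) /\ 0 <= p z <= g (f z)].
Proof.
move=> mD mg mp mf.
have mfD : measurable (f @^-1` D) by rewrite -[X in measurable X]setTI; exact: mf.
have mgf : measurable_fun (f @^-1` D) (g \o f).
  by apply: (measurable_comp mD) => //; [move=> _ [z ? <-]|exact: measurable_funTS].
have mp' : measurable_fun (f @^-1` D) p by exact: measurable_funTS.
have := measurable_and (measurable_fun_ler (measurable_cst (0 : R)) mp')
  (measurable_fun_ler mp' mgf).
move=> /(_ mfD [set true]) mA.
rewrite [X in measurable X](_ : _ = f @^-1` D `&`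
  (fun z => (0 <= p z) && (p z <= g (f z))) @^-1` [set true]); first exact: mA.
by apply/seteqP; split.
Qed.

(** Cavalieri's principle as an upper bound; [s x] will be the section at [x]
    of a planar region, in either of the two directions. *)
Lemma integral_sections_le (D : set R) (g : R -> R) (s : R -> set R) :
  measurable D -> measurable_fun D g -> (forall x, D x -> 0 <= g x) ->
  (forall x, measurable (s x)) -> measurable_fun [set: R] (mu \o s) ->
  (forall x y, s x y -> D x /\ 0 <= y <= g x) ->
  (\int[mu]_x mu (s x) <= \int[mu]_(x in D) (g x)%:E)%E.
Proof.
move=> mD mg g0 ms mmus sg.
rewrite [leRHS]integral_mkcond; apply: ge0_le_integral => //.
  by apply: (measurable_restrictT _ mD).1; exact/measurable_EFinP.
move=> x _; rewrite patchE; case: ifPn => [|/negP Dx].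
  rewrite inE => Dx; apply: (@le_trans _ _ (mu `[0, g x])).
    apply: le_measure; rewrite ?inE //=; first exact: ms.
    by move=> y /sg [_]; rewrite /= in_itv.
  rewrite lebesgue_measure_itv /= lte_fin; case: ifPn => _.
    by rewrite -EFinB subr0.
  by rewrite lee_fin g0.
rewrite (_ : s x = set0) ?measure0//; apply/seteqP; split=> // y /sg [Dx' _].
by apply: Dx; rewrite inE.
Qed.

(** The two regions [v <= g u] and [u <= h v] cover the rectangle, and each has
    area at most an integral: slice the first one vertically and the second
    one horizontally, the two iterated integrals defining the same planar
    measure. *)
Lemma rectangle_le_integrals (g h : R -> R) (a b : R) :
  0 <= a -> 0 <= b ->
  measurable_fun `[0, a] g -> measurable_fun `[0, b] h ->
  {in `[0, a], forall u, 0 <= g u} -> {in `[0, b], forall v, 0 <= h v} ->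
  (forall u v, u \in `[0, a] -> v \in `[0, b] -> v <= g u \/ u <= h v) ->
  ((a * b)%:E <= \int[mu]_(u in `[0%R, a]) (g u)%:E
                + \int[mu]_(v in `[0%R, b]) (h v)%:E)%E.
Proof.
move=> a0 b0 mg mh g0 h0 cover.
pose G : set (R * R) := [set z | `[0, a]%classic z.1 /\ 0 <= z.2 <= g z.1].
pose H : set (R * R) := [set z | `[0, b]%classic z.2 /\ 0 <= z.1 <= h z.2].
have mG : measurable G by apply: measurable_undergraph.
have mH : measurable H by apply: measurable_undergraph.
have mu0 c : 0 <= c -> mu `[0, c] = c%:E.
  move=> c0; rewrite lebesgue_measure_itv /= lte_fin -EFinB subr0.
  by case: ltP => // c0'; congr EFin; apply/eqP; rewrite eq_le c0 c0'.
have muG : ((mu \x mu) G <= \int[mu]_(u in `[0%R, a]) (g u)%:E)%E.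
  apply: integral_sections_le => //.
  - by move=> u; exact: measurable_xsection.
  - exact: measurable_fun_xsection.
  - by move=> u v /xsectionP.
have muH : ((mu \x mu) H <= \int[mu]_(v in `[0%R, b]) (h v)%:E)%E.
  (* slicing horizontally requires the other iterated integral *)
  rewrite (product_measure_unique (m' := (mu \x^ mu)%E)) //; last first.
    by move=> A B mA mB; rewrite /= product_measure2E.
  apply: integral_sections_le => //.
  - by move=> v; exact: measurable_ysection.
  - exact: measurable_fun_ysection.
  - by move=> v u /ysectionP.
apply: (le_trans _ (leeD muG muH)).
rewrite EFinM -(mu0 a)// -(mu0 b)// -product_measure1E//.
have := measureU2 (product_measure1 mu mu : {measure set (_ * _) -> \bar R}) mG mH.
apply: le_trans; apply: le_measure.
- by rewrite inE; exact: measurableX.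
- by rewrite inE; exact: measurableU.
move=> [u v] [/= ua vb]; have := cover u v ua vb.
move: (ua) (vb); rewrite !in_itv/= => /andP[u0 _] /andP[v0 _].
by case=> uv; [left|right]; split; rewrite //= ?u0 ?v0.
Qed.

(** The kernels are only controlled on the half-line; composing with the
    projection onto it gives a globally monotone function. *)
Lemma nondecreasing_itv_measurable (g : R -> R) (a : R) :
  {in `[0, +oo[ &, {homo g : u v / u <= v}} -> measurable_fun `[0, a] g.
Proof.
move=> g_nd.
have : measurable_fun `[0, a] (fun u => g (Num.max 0 u)).
  apply: nondecreasing_measurable => // u v uv.
  apply: g_nd; last by rewrite ge_max !le_max lexx uv orbT.
    by rewrite in_itv/= andbT le_max lexx.
  by rewrite in_itv/= andbT le_max lexx.
apply: eq_measurable_fun => u; rewrite inE/= in_itv/= => /andP[u0 _].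
by rewrite (max_idPr u0).
Qed.

Section KernelInverse.
Variable gamma : R -> R.
Hypothesis gammaK : orlicz_kernel gamma.

Lemma kernel_ge0 u : 0 <= u -> 0 <= gamma u.
Proof.
have [_ gamma0 gamma_gt0 _] := gammaK.
by rewrite le_eqVlt => /predU1P[<-|/gamma_gt0/ltW //]; rewrite gamma0.
Qed.

(** This is where [gamma] tending to infinity is needed: it makes the supremum
    defining the right inverse a finite one. *)
Lemma kernel_sublevel_has_ubound v :
  has_ubound [set u | 0 <= u /\ gamma u <= v].
Proof.
have [gamma_nd _ _ /cvgryPge/(_ (v + 1)) /pinfty_ex_gt0[M M0 vM]] := gammaK.
exists M => u [u0 uv]; rewrite leNgt; apply/negP => /ltW Mu.
have := gamma_nd M u; rewrite !in_itv/= !andbT (ltW M0) u0 => /(_ isT isT Mu).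
by move: vM uv => /=; lra.
Qed.

Lemma kernel_le_rinv u v : 0 <= u -> gamma u <= v -> u <= kernel_rinv gamma v.
Proof. by move=> u0 uv; apply: ub_le_sup => //; exact: kernel_sublevel_has_ubound. Qed.

Lemma kernel_rinv_ge0 v : 0 <= v -> 0 <= kernel_rinv gamma v.
Proof. by have [_ gamma0 _ _] := gammaK => v0; rewrite kernel_le_rinv ?gamma0. Qed.

Lemma kernel_rinv_nondecreasing :
  {in `[0, +oo[ &, {homo kernel_rinv gamma : u v / u <= v}}.
Proof.
have [_ gamma0 _ _] := gammaK.
move=> v w; rewrite !in_itv/= !andbT => v0 w0 vw.
apply: ge_sup; first by exists 0; rewrite /= gamma0.
by move=> u [u0 uv]; apply: kernel_le_rinv => //; exact: le_trans vw.
Qed.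

End KernelInverse.

Lemma young_complementary (phi psi : R -> R) (a b : R) :
  complementary phi psi -> 0 <= a -> 0 <= b -> a * b <= phi a + psi b.
Proof.
move=> [gamma [gammaK phiE psiE]] a0 b0.
rewrite -lee_fin EFinD phiE// psiE//.
have [gamma_nd _ _ _] := gammaK.
apply: rectangle_le_integrals => //.
- exact: nondecreasing_itv_measurable.
- by apply: nondecreasing_itv_measurable; exact: kernel_rinv_nondecreasing.
- by move=> u; rewrite in_itv/= => /andP[u0 _]; exact: kernel_ge0.
- by move=> v; rewrite in_itv/= => /andP[v0 _]; exact: kernel_rinv_ge0.
move=> u v; rewrite !in_itv/= => /andP[u0 _] _.
have [|/ltW vu] := leP v (gamma u); first by left.
by right; exact: kernel_le_rinv.
Qed.

End Young.

(** * Inner product, norms and Hermitian matrices *)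

Local Notation adj A := (map_mx (@conjc _) A^T).

Section ComplexParts.
Variable R : realType.
Implicit Types z w : R[i].

Lemma ReD z w : complex.Re (z + w) = complex.Re z + complex.Re w.
Proof. by case: z w => [? ?] [? ?]. Qed.

Lemma ReN z : complex.Re (- z) = - complex.Re z.
Proof. by case: z. Qed.

Lemma ReC z : complex.Re (conjc z) = complex.Re z.
Proof. by case: z. Qed.

Lemma ReZ (r : R) z : complex.Re (r%:C%C * z) = r * complex.Re z.
Proof. by case: z => a b /=; rewrite mul0r subr0. Qed.

Lemma ImZ (r : R) z : complex.Im (r%:C%C * z) = r * complex.Im z.
Proof. by case: z => a b /=; rewrite mul0r addr0. Qed.

Lemma cmodE2 z : cmod z ^+ 2 = complex.Re z ^+ 2 + complex.Im z ^+ 2.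
Proof. by case: z => a b; rewrite sqr_sqrtr ?addr_ge0 ?sqr_ge0. Qed.

Lemma cmod_ge0 z : 0 <= cmod z.
Proof. by case: z => a b; exact: sqrtr_ge0. Qed.

Lemma cmodC z : cmod (conjc z) = cmod z.
Proof. by case: z => a b /=; rewrite sqrrN. Qed.

Lemma cmod_real (r : R) : cmod r%:C%C = `|r|.
Proof. by rewrite /= expr0n addr0 sqrtr_sqr. Qed.

Lemma Re_le_cmod z : `|complex.Re z| <= cmod z.
Proof. by case: z => a b /=; rewrite -sqrtr_sqr ler_wsqrtr// lerDl sqr_ge0. Qed.

Lemma mulJc z : conjc z * z = (cmod z ^+ 2)%:C%C.
Proof.
rewrite cmodE2; case: z => a b; apply/eqP; rewrite eq_complex /=.
by apply/andP; split; apply/eqP; ring.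
Qed.

End ComplexParts.

(** The real-number core of the Cartesian bound, from
    [(P + Q)^2 <= 2 (P^2 + Q^2) = U^2 + V^2]. *)
Lemma add_le_sqrt (R : rcfType) (P Q U V h k X : R) :
  0 <= P -> 0 <= Q -> 0 <= U -> 0 <= V -> 0 <= X ->
  U <= 2 * h * X -> V <= 2 * k * X -> U ^+ 2 + V ^+ 2 = 2 * (P ^+ 2 + Q ^+ 2) ->
  P + Q <= 2 * Num.sqrt (h ^+ 2 + k ^+ 2) * X.
Proof.
move=> P0 Q0 U0 V0 X0 Uh Vk UV.
have s0 : 0 <= h ^+ 2 + k ^+ 2 by rewrite addr_ge0 ?sqr_ge0.
rewrite -(@ler_pXn2r _ 2)// ?nnegrE ?addr_ge0 ?mulr_ge0 ?sqrtr_ge0//.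
rewrite !exprMn (sqr_sqrtr s0).
have sq (a b : R) : 0 <= a -> a <= b -> a ^+ 2 <= b ^+ 2.
  by move=> a0 ab; rewrite ler_pXn2r ?nnegrE// (le_trans a0).
have := sq _ _ U0 Uh; have := sq _ _ V0 Vk.
rewrite !exprMn; have := sqr_ge0 (P - Q).
by rewrite sqrrB sqrrD mulrDr mulrDl; lra.
Qed.

Section InnerProduct.
Variables (R : realType) (n : nat).
Local Notation C := R[i].
Implicit Types (x y z : 'cV[C]_n) (A : 'M[C]_n).

Lemma innerE x y : inner x y = \sum_i conjc (y i 0) * x i 0.
Proof. by rewrite /inner mxE; apply: eq_bigr => i _; rewrite !mxE. Qed.

Lemma innerDl x y z : inner (x + y) z = inner x z + inner y z.
Proof. by rewrite /inner mulmxDr mxE. Qed.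

Lemma innerZl c x y : inner (c *: x) y = c * inner x y.
Proof. by rewrite /inner -scalemxAr mxE. Qed.

Lemma inner_conj x y : conjc (inner x y) = inner y x.
Proof.
rewrite !innerE rmorph_sum; apply: eq_bigr => i _.
by rewrite rmorphM /= conjcK mulrC.
Qed.

Lemma innerDr x y z : inner x (y + z) = inner x y + inner x z.
Proof. by rewrite -inner_conj innerDl rmorphD /= !inner_conj. Qed.

Lemma innerZr c x y : inner x (c *: y) = conjc c * inner x y.
Proof. by rewrite -inner_conj innerZl rmorphM /= inner_conj. Qed.

Lemma innerNl x y : inner (- x) y = - inner x y.
Proof. by rewrite -scaleN1r innerZl mulN1r. Qed.

Lemma innerNr x y : inner x (- y) = - inner x y.
Proof. by rewrite -inner_conj innerNl rmorphN /= inner_conj. Qed.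

Lemma inner_adj A x y : inner (A *m x) y = inner x (adj A *m y).
Proof.
rewrite /inner trmx_mul map_mxM /= -!map_trmx trmxK mulmxA.
congr ((_ *m _ *m _) 0 0).
by apply/matrixP => i j; rewrite !mxE conjcK.
Qed.

Lemma vnorm_sum x : vnorm x ^+ 2 = \sum_i cmod (x i 0) ^+ 2.
Proof.
have -> : vnorm x ^+ 2 = complex.Re (inner x x) :> R.
  rewrite /vnorm sqr_sqrtr// innerE.
  under eq_bigr do rewrite mulJc.
  by rewrite -rmorph_sum /=; apply: sumr_ge0 => i _; exact: sqr_ge0.
rewrite innerE; under eq_bigr do rewrite mulJc.
by rewrite -rmorph_sum.
Qed.

Lemma innerxx x : inner x x = (vnorm x ^+ 2)%:C%C.
Proof.
rewrite vnorm_sum innerE rmorph_sum; apply: eq_bigr => i _; exact: mulJc.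
Qed.

Lemma vnorm_ge0 x : 0 <= vnorm x.
Proof. exact: sqrtr_ge0. Qed.

Lemma vnorm0 : vnorm (0 : 'cV[C]_n) = 0.
Proof. by rewrite /vnorm /inner mulmx0 mxE sqrtr0. Qed.

Lemma vnorm_eq0 x : vnorm x = 0 -> x = 0.
Proof.
move=> x0; have := vnorm_sum x; rewrite x0 expr0n /= => /esym/eqP.
rewrite psumr_eq0 => [/allP xi0|i _]; last exact: sqr_ge0.
apply/matrixP => i j; rewrite ord1 mxE; apply: Normc.eq0_normc.
by have := xi0 i (mem_index_enum i); rewrite expf_eq0 => /eqP.
Qed.

Lemma vnormZ c x : vnorm (c *: x) = cmod c * vnorm x.
Proof.
apply/eqP; rewrite -(@eqrXn2 _ 2)// ?mulr_ge0 ?cmod_ge0 ?vnorm_ge0//.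
rewrite exprMn !vnorm_sum mulr_sumr; apply/eqP/eq_bigr => i _.
by rewrite mxE Normc.normcM exprMn.
Qed.

Lemma vnormD2 x y :
  vnorm (x + y) ^+ 2 = vnorm x ^+ 2 + 2 * complex.Re (inner x y) + vnorm y ^+ 2.
Proof.
have sqE z : vnorm z ^+ 2 = complex.Re (inner z z) by rewrite innerxx.
rewrite !sqE innerDl !innerDr !ReD -(inner_conj x y) ReC.
by move: (inner x x) (inner x y) (inner y y) => X Z Y; ring.
Qed.

Lemma vnormN x : vnorm (- x) = vnorm x.
Proof. by rewrite -scaleN1r vnormZ normcN Normc.normc1 mul1r. Qed.

Lemma parallelogram x y :
  vnorm (x + y) ^+ 2 + vnorm (x - y) ^+ 2 = 2 * (vnorm x ^+ 2 + vnorm y ^+ 2).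
Proof.
rewrite (vnormD2 x y) (vnormD2 x (- y)) innerNr ReN vnormN.
by move: (vnorm x) (vnorm y) (complex.Re _) => X Y Z; ring.
Qed.

(** Expand the square of the norm of [|y|^2 x - <x, y> y]. *)
Lemma cauchy_schwarz x y : cmod (inner x y) <= vnorm x * vnorm y.
Proof.
have [y0|y_neq0] := eqVneq (vnorm y) 0.
  by rewrite (vnorm_eq0 y0) /inner trmx0 map_mx0 mul0mx mxE Normc.normc0 vnorm0 mulr0.
rewrite -(@ler_pXn2r _ 2)// ?nnegrE ?mulr_ge0 ?cmod_ge0 ?vnorm_ge0//.
have y2_gt0 : 0 < vnorm y ^+ 2 by rewrite exprn_even_gt0.
have := sqr_ge0 (vnorm ((vnorm y ^+ 2)%:C%C *: x - inner x y *: y)).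
rewrite vnormD2 vnormN !vnormZ innerNr innerZl innerZr mulJc ReN ReZ.
rewrite cmod_real ger0_norm ?sqr_ge0//= => H.
rewrite -(ler_pM2l y2_gt0) -subr_ge0; move: H.
by set p := cmod _; congr (_ <= _); ring.
Qed.

(** The zero vector is kept apart because there may be no unit vector at all. *)
Lemma vnormalize x :
  x = 0 \/ exists2 e, vnorm e = 1 & x = (vnorm x)%:C%C *: e.
Proof.
have [/vnorm_eq0|x0] := eqVneq (vnorm x) 0; [by left|right].
exists ((vnorm x)^-1%:C%C *: x); last first.
  by rewrite scalerA -rmorphM /= divff// scale1r.
by rewrite vnormZ cmod_real ger0_norm ?invr_ge0 ?vnorm_ge0// mulVf.
Qed.

(** Without boundedness the suprema defining [opnorm] and [qradius] would carry
    no information. The constant is the Frobenius norm: each coordinate of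
    [A x] is an inner product with a row of [A]. *)
Lemma mulmx_bounded A : exists K, forall x, vnorm (A *m x) <= K * vnorm x.
Proof.
pose r i : 'cV[C]_n := adj (row i A).
exists (Num.sqrt (\sum_i vnorm (r i) ^+ 2)) => x.
have K0 : 0 <= \sum_i vnorm (r i) ^+ 2 by apply: sumr_ge0 => i _; exact: sqr_ge0.
rewrite -(@ler_pXn2r _ 2)// ?nnegrE ?mulr_ge0 ?sqrtr_ge0 ?vnorm_ge0//.
rewrite exprMn (sqr_sqrtr K0) mulr_suml vnorm_sum; apply: ler_sum => i _.
rewrite -exprMn ler_pXn2r ?nnegrE ?mulr_ge0 ?cmod_ge0 ?vnorm_ge0// mulrC.
have -> : (A *m x) i 0 = inner x (r i).
  rewrite innerE mxE; apply: eq_bigr => j _.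
  by rewrite !mxE conjcK.
exact: cauchy_schwarz.
Qed.

Lemma opnorm_ub A x : vnorm x = 1 -> vnorm (A *m x) <= opnorm A.
Proof.
move=> x1; apply: ub_le_sup; last by exists x.
have [K AK] := mulmx_bounded A.
by exists K => _ [y y1 ->]; rewrite (le_trans (AK y))// y1 mulr1.
Qed.

Lemma vnorm_mulmx A x : vnorm (A *m x) <= opnorm A * vnorm x.
Proof.
have [->|[e e1 ->]] := vnormalize x; first by rewrite mulmx0 vnorm0 mulr0.
rewrite -scalemxAr !vnormZ e1 mulr1 mulrC.
by rewrite ler_wpM2r ?cmod_ge0 ?opnorm_ub.
Qed.

Lemma qradius_ub q A x y : vnorm x = 1 -> vnorm y = 1 -> inner x y = q ->
  cmod (inner (A *m x) y) <= qradius q A.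
Proof.
move=> x1 y1 xy; apply: ub_le_sup; last first.
  by exists (inner (A *m x) y) => //; exists x, y.
exists (opnorm A) => _ [_ [x' [y' [x1' y1' _ ->]]] <-].
by rewrite (le_trans (cauchy_schwarz _ _))// y1' mulr1 opnorm_ub.
Qed.

(** By polarization [4 Re <A x, y> = <A (x + y), x + y> - <A (x - y), x - y>],
    and the parallelogram identity bounds this by [2 h (|x|^2 + |y|^2)]; the
    choice of [y] proportional to [A x] with [|y| = |x|] gives the claim. *)
Lemma hermitian_vnorm_le A h : adj A = A ->
  (forall x, `|complex.Re (inner (A *m x) x)| <= h * vnorm x ^+ 2) ->
  forall x, vnorm (A *m x) <= h * vnorm x.
Proof.
move=> AA Ah x.
have pol x' y' : 2 * complex.Re (inner (A *m x') y')
    <= h * (vnorm x' ^+ 2 + vnorm y' ^+ 2).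
  have sym : complex.Re (inner (A *m y') x') = complex.Re (inner (A *m x') y').
    by rewrite inner_adj AA -inner_conj ReC.
  have := ler_normlW (Ah (x' + y')).
  have := Ah (x' - y'); rewrite -normrN => /ler_normlW.
  rewrite !mulmxDr !mulmxN !innerDl !innerDr !innerNl !innerNr !ReD !ReN sym.
  have := parallelogram x' y'.
  move: (vnorm (x' + y')) (vnorm (x' - y')) (vnorm x') (vnorm y') => P Q X Y par.
  have -> : h * (X ^+ 2 + Y ^+ 2) = (h * P ^+ 2 + h * Q ^+ 2) / 2.
    by rewrite -mulrDr par; field.
  by move: (complex.Re _) (complex.Re _) (complex.Re _) (h * _) (h * _) => *; lra.
have [/vnorm_eq0 ->|x0] := eqVneq (vnorm x) 0.
  by rewrite mulmx0 vnorm0 mulr0.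
have [->|z0] := eqVneq (vnorm (A *m x)) 0.
  have := le_trans (normr_ge0 _) (Ah x).
  by rewrite pmulr_lge0 ?exprn_even_gt0// => h0; rewrite mulr_ge0 ?vnorm_ge0.
(* both arguments have norm |x| |Ax|, which avoids a division *)
have := pol ((vnorm (A *m x))%:C%C *: x) ((vnorm x)%:C%C *: (A *m x)).
rewrite -scalemxAr innerZl innerZr innerxx conjc_real -!rmorphM /= !vnormZ.
rewrite !cmod_real !ger0_norm ?vnorm_ge0//.
have xgt0 : 0 < vnorm x by rewrite lt_def x0 vnorm_ge0.
have zgt0 : 0 < vnorm (A *m x) by rewrite lt_def z0 vnorm_ge0.
move: (vnorm x) (vnorm (A *m x)) xgt0 zgt0 => X Z X0 Z0 H.
have c0 : 0 < 2 * Z ^+ 2 * X by rewrite !mulr_gt0 ?exprn_gt0.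
by rewrite -(ler_pM2l c0); move: H; congr (_ <= _); ring.
Qed.

Lemma adjD A B : adj (A + B) = adj A + adj B :> 'M[C]_n.
Proof. by rewrite linearD map_mxD. Qed.

Lemma adjZ c A : adj (c *: A) = conjc c *: adj A.
Proof. by apply/matrixP => i j; rewrite !mxE rmorphM. Qed.

Lemma adjK A : adj (adj A) = A.
Proof. by apply/matrixP => i j; rewrite !mxE conjcK. Qed.

(** The vector on the left is the image of [x] under twice the Hermitian part of
    [u A], whose quadratic form is the real part of that of [u A]. *)
Lemma realpart_vnorm_le A u h :
  (forall x, `|complex.Re (u * inner (A *m x) x)| <= h * vnorm x ^+ 2) ->
  forall x, vnorm (u *: (A *m x) + conjc u *: (adj A *m x)) <= 2 * h * vnorm x.
Proof.
move=> Ah x; pose G := u *: A + conjc u *: adj A.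
have -> : u *: (A *m x) + conjc u *: (adj A *m x) = G *m x.
  by rewrite mulmxDl -!scalemxAl.
apply: hermitian_vnorm_le; first by rewrite adjD !adjZ adjK conjcK addrC.
move=> y; rewrite mulmxDl innerDl -!scalemxAl !innerZl ReD.
have -> : conjc u * inner (adj A *m y) y = conjc (u * inner (A *m y) y).
  by rewrite inner_adj adjK rmorphM /= inner_conj.
rewrite ReC; move: (Ah y); move: (complex.Re _) => t {}Ah.
have -> : t + t = 2 * t by ring.
by rewrite normrM normr_nat -mulrA ler_pM2l.
Qed.

(** The imaginary part of the form of [u A] is the real part of that of [-i u A],
    so both parts are controlled by [realpart_vnorm_le]. *)
Lemma cartesian_vnorm_le A u h k : cmod u = 1 ->
  (forall x, `|complex.Re (u * inner (A *m x) x)| <= h * vnorm x ^+ 2) ->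
  (forall x, `|complex.Im (u * inner (A *m x) x)| <= k * vnorm x ^+ 2) ->
  forall x, vnorm (A *m x) + vnorm (adj A *m x)
            <= 2 * Num.sqrt (h ^+ 2 + k ^+ 2) * vnorm x.
Proof.
move=> u1 Ah Ak x.
pose p := u *: (A *m x); pose r := conjc u *: (adj A *m x).
have pE : vnorm (A *m x) = vnorm p by rewrite vnormZ u1 mul1r.
have rE : vnorm (adj A *m x) = vnorm r by rewrite vnormZ cmodC u1 mul1r.
pose i : C := Complex 0 1.
have i1 : cmod i = 1 by rewrite /= expr0n expr1n add0r sqrtr1.
have hp : vnorm (p + r) <= 2 * h * vnorm x by exact: realpart_vnorm_le.
have kp : vnorm (p - r) <= 2 * k * vnorm x.
  have -> : vnorm (p - r) = vnorm (- i *: (p - r)).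
    by rewrite [RHS]vnormZ normcN i1 mul1r.
  have iJ : conjc (- i * u) = i * conjc u.
    rewrite rmorphM rmorphN /=; congr (_ * _).
    by apply/eqP; rewrite eq_complex /= oppr0 opprK !eqxx.
  have -> : - i *: (p - r)
      = (- i * u) *: (A *m x) + conjc (- i * u) *: (adj A *m x).
    rewrite scalerBr !scalerA iJ; congr (_ + _).
    by rewrite -scaleNr mulNr opprK.
  apply: realpart_vnorm_le => y.
  suff -> : complex.Re (- i * u * inner (A *m y) y)
      = complex.Im (u * inner (A *m y) y).
    exact: Ak.
  rewrite -mulrA; case: (u * _) => a b /=.
  by rewrite oppr0 mul0r mulN1r opprK add0r.
rewrite pE rE; have := parallelogram p r.
apply: add_le_sqrt; rewrite ?vnorm_ge0 //.
Qed.

End InnerProduct.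

(** * The q-numerical radius *)

Section QRadius.
Variables (R : realType) (n : nat).
Local Notation C := R[i].
Implicit Types (x y z : 'cV[C]_n) (A T : 'M[C]_n) (q : C).

(** The linear form [<., x>] has a nonzero kernel in dimension at least 2. *)
Lemma orthogonal_unit_vector x : (2 <= n)%N ->
  exists2 z, vnorm z = 1 & inner x z = 0.
Proof.
move=> n2; pose K := kermx (adj x)^T.
have Kn0 : nz_row K != 0.
  rewrite nz_row_eq0 kermx_eq0 /row_free ltn_eqF//.
  by rewrite (leq_ltn_trans (rank_leq_col _)).
have xK : inner (nz_row K)^T x = 0.
  have /sub_kermxP H := nz_row_sub K.
  by rewrite /inner -[_ *m _]trmxK trmx_mul trmxK H !mxE.
have [K0|[e e1 eE]] := vnormalize (nz_row K)^T.
  by move: Kn0; rewrite -[nz_row K]trmxK K0 trmx0 eqxx.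
exists e => //; apply/eqP; rewrite -inner_conj conjc_eq0.
move: xK; rewrite eE innerZl => /eqP; rewrite mulf_eq0 => /orP[|//].
have : (nz_row K)^T != 0.
  by apply: contra Kn0 => /eqP K0; rewrite -[nz_row K]trmxK K0 trmx0.
rewrite {1}eE => nz /eqP c0; by move: nz; rewrite c0 scale0r eqxx.
Qed.

(** Here [z] is orthogonal to [x] and has norm [sqrt (1 - |q|^2)]; for [|q| = 1]
    it vanishes, which is why dimension 1 is then allowed. *)
Lemma q_companions q x : cmod q <= 1 -> (cmod q < 1 -> (2 <= n)%N) ->
  vnorm x = 1 -> exists z,
  [/\ vnorm (conjc q *: x + z) = 1, vnorm (conjc q *: x - z) = 1,
      inner x (conjc q *: x + z) = q & inner x (conjc q *: x - z) = q].
Proof.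
move=> q1 n2 x1; set s := Num.sqrt (1 - cmod q ^+ 2).
have s2 : s ^+ 2 = 1 - cmod q ^+ 2.
  by rewrite sqr_sqrtr// subr_ge0 exprn_ile1 ?cmod_ge0.
suff [z zs xz] : exists2 z, vnorm z = s & inner x z = 0.
  exists z; have qx : inner x (conjc q *: x) = q.
    by rewrite innerZr conjcK innerxx x1 expr1n mulr1.
  have re0 : complex.Re (inner (conjc q *: x) z) = 0 by rewrite innerZl xz mulr0.
  have unit y : vnorm y ^+ 2 = 1 -> vnorm y = 1.
    by move=> y1; apply/eqP; rewrite -sqrp_eq1 ?vnorm_ge0 // y1.
  have qn : vnorm (conjc q *: x) = cmod q by rewrite vnormZ cmodC x1 mulr1.
  split; rewrite ?innerDr ?innerNr ?xz ?oppr0 ?addr0//; apply: unit.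
    by rewrite vnormD2 re0 qn zs s2 mulr0 addr0 addrC subrK.
  by rewrite vnormD2 innerNr ReN re0 vnormN qn zs s2 oppr0 mulr0 addr0 addrC subrK.
move: q1; rewrite le_eqVlt => /orP[/eqP q1|q_lt1].
  exists 0; first by rewrite vnorm0 /s q1 expr1n subrr sqrtr0.
  by rewrite /inner trmx0 map_mx0 mul0mx mxE.
have [e e1 xe] := orthogonal_unit_vector x (n2 q_lt1).
exists (s%:C%C *: e); last by rewrite innerZr xe mulr0.
by rewrite vnormZ cmod_real e1 mulr1 ger0_norm ?sqrtr_ge0.
Qed.

(** [2 q <A x, x>] is the sum of the two points of the q-numerical range given
    by [q_companions]. *)
Lemma numradius_le_qradius q A x : cmod q <= 1 ->
  (cmod q < 1 -> (2 <= n)%N) -> vnorm x = 1 ->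
  cmod (q * inner (A *m x) x) <= qradius q A.
Proof.
move=> q1 n2 x1; have [z [y1 y1' xy xy']] := q_companions q1 n2 x1.
have := qradius_ub A x1 y1 xy; have := qradius_ub A x1 y1' xy'.
set y := _ + z; set y' := _ - z => H' H.
have E : 2%:C%C * (q * inner (A *m x) x) = inner (A *m x) y + inner (A *m x) y'.
  by rewrite /y /y' !innerDr innerNr innerZr conjcK; ring.
rewrite -(@ler_pM2l _ 2)// -[X in X * cmod _]normr_nat -cmod_real -Normc.normcM E.
by rewrite (le_trans (le_normcD _ _))// mulr2n mulrDl !mul1r lerD.
Qed.

(** [q <A x, x>] is the midpoint of two points of the q-numerical range, and the
    sector is convex. *)
Lemma qsectorial_inner q alpha A x : cmod q <= 1 ->
  (cmod q < 1 -> (2 <= n)%N) -> vnorm x = 1 -> qsectorial q alpha A ->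
  `|complex.Im (q * inner (A *m x) x)|
    <= tan alpha * complex.Re (q * inner (A *m x) x).
Proof.
move=> q1 n2 x1 Asect; have [z [y1 y1' xy xy']] := q_companions q1 n2 x1.
have [|_] := Asect (inner (A *m x) (conjc q *: x + z)); first
  by exists x, (conjc q *: x + z).
have [|_] := Asect (inner (A *m x) (conjc q *: x - z)); first
  by exists x, (conjc q *: x - z).
rewrite !innerDr innerNr innerZr conjcK.
case: (q * _) => a b; case: (inner _ _) => c d /=.
move=> H1 H2; have := ler_normD (b - d) (b + d).
have -> : b - d + (b + d) = 2 * b by ring.
rewrite normrM normr_nat => H3.
rewrite -(@ler_pM2l _ 2)//; apply: (le_trans H3); apply: (le_trans (lerD H1 H2)).
by rewrite le_eqVlt; apply/orP; left; apply/eqP; ring.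
Qed.

Lemma sin_ge0_acute (alpha : R) : 0 <= alpha -> alpha < pi / 2 -> 0 <= sin alpha.
Proof.
move=> a0 api; apply: sin_ge0_pi; rewrite a0 (le_trans (ltW api))//.
by rewrite ler_pdivrMr// ler_peMr ?pi_ge0// ler1n.
Qed.

Lemma sector_Im_le (alpha : R) (z : C) : 0 <= alpha -> alpha < pi / 2 ->
  `|complex.Im z| <= tan alpha * complex.Re z ->
  `|complex.Im z| <= sin alpha * cmod z.
Proof.
move=> a0 api zS.
have c0 : 0 < cos alpha.
  apply: cos_gt0_pihalf; rewrite api andbT (lt_le_trans _ a0)// oppr_lt0.
  by rewrite divr_gt0// pi_gt0.
have s0 := sin_ge0_acute a0 api.
have : (`|complex.Im z| * cos alpha) ^+ 2 <= (sin alpha * complex.Re z) ^+ 2.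
  have H : `|complex.Im z| * cos alpha <= sin alpha * complex.Re z.
    rewrite (le_trans (ler_wpM2r (ltW c0) zS))// mulrAC /tan divfK//.
    by rewrite gt_eqF.
  have H0 : 0 <= `|complex.Im z| * cos alpha by rewrite mulr_ge0 // ltW.
  by rewrite ler_pXn2r ?nnegrE// (le_trans H0).
move=> sq_le; rewrite -(@ler_pXn2r _ 2)// ?nnegrE ?mulr_ge0 ?cmod_ge0//.
move: sq_le; rewrite !exprMn cmodE2 real_normK ?num_real// cos2sin2; lra.
Qed.

(** The component of [y] orthogonal to [x] has norm [sqrt (1 - |q|^2)], and its
    contribution is bounded by Cauchy-Schwarz. *)
Lemma qradius_le q T w : cmod q <= 1 ->
  (cmod q < 1 -> (2 <= n)%N) -> (1 <= n)%N ->
  (forall x, vnorm x = 1 -> cmod (inner (T *m x) x) <= w) ->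
  qradius q T <= cmod q * w + Num.sqrt (1 - cmod q ^+ 2) * opnorm T.
Proof.
move=> q1 n2 n1 Tw; apply: ge_sup.
  have [e e1] : exists e : 'cV[C]_n, vnorm e = 1.
    have [|[e e1 _]] := vnormalize (const_mx 1 : 'cV[C]_n).
      by move=> /matrixP/(_ (Ordinal n1) 0); rewrite !mxE => /eqP; rewrite oner_eq0.
    by exists e.
  have [z [y1 _ xy _]] := q_companions q1 n2 e1.
  pose y := conjc q *: e + z; exists (cmod (inner (T *m e) y)).
  by exists (inner (T *m e) y) => //; exists e, y.
move=> _ [_ [x [y [x1 y1 xy ->]] <-]].
pose z := y - conjc q *: x.
have yE : y = conjc q *: x + z by rewrite addrC subrK.
have xz : inner x z = 0.
  by rewrite innerDr innerNr innerZr conjcK xy innerxx x1 expr1n mulr1 subrr.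
have zn : vnorm z = Num.sqrt (1 - cmod q ^+ 2).
  have := vnormD2 (conjc q *: x) z.
  rewrite -yE y1 innerZl xz mulr0 mulr0 addr0 vnormZ cmodC x1 mulr1 expr1n => ->.
  by rewrite addrAC subrr add0r sqrtr_sqr ger0_norm ?vnorm_ge0.
rewrite yE innerDr innerZr conjcK (le_trans (le_normcD _ _))// lerD//.
  by rewrite Normc.normcM ler_wpM2l ?cmod_ge0 ?Tw.
rewrite (le_trans (cauchy_schwarz _ _))// zn mulrC ler_wpM2l ?sqrtr_ge0//.
exact: opnorm_ub.
Qed.

(** [<A X B x, x> = <X B x, A^* x>] and [<B Y A x, x> = <(B Y) (A x), x>], so the
    operator norms of [X B] and [B Y] factor out. *)
Lemma inner_generalized_commutator_le A B X Y (eps : bool) x : vnorm x = 1 ->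
  cmod (inner ((A *m X *m B + (-1) ^+ eps *: (B *m Y *m A)) *m x) x)
  <= Num.max (opnorm (X *m B)) (opnorm (B *m Y))
     * (vnorm (A *m x) + vnorm (adj A *m x)).
Proof.
move=> x1; rewrite mulmxDl innerDl -scalemxAl innerZl.
rewrite (le_trans (le_normcD _ _))// mulrDr addrC lerD//.
  have -> : cmod ((-1) ^+ eps * inner (B *m Y *m A *m x) x)
      = cmod (inner (B *m Y *m A *m x) x) :> R.
    by case: eps; rewrite ?expr0 ?mul1r// expr1 mulN1r normcN.
  rewrite (le_trans (cauchy_schwarz _ _))// x1 mulr1 -mulmxA.
  rewrite (le_trans (vnorm_mulmx _ _))// ler_wpM2r ?vnorm_ge0//.
  by rewrite le_max; apply/orP; right; exact: lexx.
rewrite -!mulmxA inner_adj (le_trans (cauchy_schwarz _ _))//.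
rewrite ler_wpM2r ?vnorm_ge0// mulmxA (le_trans (opnorm_ub _ x1))//.
by rewrite le_max; apply/orP; left; exact: lexx.
Qed.

End QRadius.

Theorem theorem4p3 (R : realType) (n : nat) (q : R[i]) (alpha : R)
    (A B X Y : 'M[R[i]]_n) (phi psi : R -> R) (eps : bool)
    (q_gt0 : 0 < cmod q) (q_le1 : cmod q <= 1)
    (n_ge1 : cmod q = 1 -> (1 <= n)%N) (n_ge2 : cmod q < 1 -> (2 <= n)%N)
    (alpha_ge0 : 0 <= alpha) (alpha_lt : alpha < pi / 2)
    (A_sect : qsectorial q alpha A)
    (phi_orlicz : orlicz phi) (psi_compl : complementary phi psi) :
  let T := A *m X *m B + (-1) ^+ eps *: (B *m Y *m A) in
  let a := (cmod q)^-1 * qradius q A in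
  let b := (sin alpha / cmod q
            + 2 * Num.sqrt (1 - cmod q ^+ 2) / cmod q ^+ 2) * qradius q A in
  qradius q T <=
    2 * cmod q * Num.max (opnorm (X *m B)) (opnorm (B *m Y))
      * Num.sqrt (phi a + psi a + phi b + psi b)
    + Num.sqrt (1 - cmod q ^+ 2) * opnorm T.
Proof.
cbv zeta; set T := A *m X *m B + _; set a := (cmod q)^-1 * _.
set b := (sin alpha / cmod q + _) * _.
have n1 : (1 <= n)%N.
  by move: q_le1; rewrite le_eqVlt => /orP[/eqP/n_ge1//|/n_ge2/ltnW].
set M := Num.max _ _.
rewrite (mulrC 2) -2!mulrA; apply: qradius_le => // x x1.
have w0 : 0 <= qradius q A.
  exact: le_trans (cmod_ge0 _) (numradius_le_qradius A q_le1 n_ge2 x1).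
have sin0 := sin_ge0_acute alpha_ge0 alpha_lt.
have a0 : 0 <= a by rewrite mulr_ge0 ?invr_ge0 ?cmod_ge0.
have sb : sin alpha * a <= b.
  rewrite /a /b mulrA ler_wpM2r// lerDl.
  by rewrite divr_ge0 ?exprn_ge0 ?cmod_ge0// mulr_ge0 ?sqrtr_ge0.
have b0 : 0 <= b by rewrite (le_trans _ sb)// mulr_ge0.
have M0 : 0 <= M.
  rewrite /M le_max; apply/orP; left.
  exact: le_trans (vnorm_ge0 (X *m B *m x)) (opnorm_ub (X *m B) x1).
apply: (le_trans (inner_generalized_commutator_le A B X Y eps x1)); rewrite -/M.
rewrite (mulrCA 2); apply: (ler_wpM2l M0).
(* rotating A by the phase of q makes q <A x, x> a positive multiple of the
   quadratic form of the rotated matrix *)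
pose u : R[i] := ((cmod q)^-1)%:C%C * q.
have u1 : cmod u = 1.
  by rewrite Normc.normcM cmod_real ger0_norm ?invr_ge0 ?cmod_ge0// mulVf ?gt_eqF.
(* bounds on unit vectors extend to all vectors by homogeneity of the form *)
have scale (f : R[i] -> R) h : (forall (r : R) z, f (r%:C%C * z) = r * f z) ->
    (forall x, vnorm x = 1 -> `|f (u * inner (A *m x) x)| <= h) ->
    forall x, `|f (u * inner (A *m x) x)| <= h * vnorm x ^+ 2.
  move=> fZ fh v; have [->|[e e1 vE]] := vnormalize v.
    rewrite mulmx0 -(mulmx0 _ A) inner_adj /inner !mulmx0 mxE mulr0.
    have := fZ 0 0; rewrite mulr0 mul0r => ->.
    by rewrite normr0 vnorm0 expr0n mulr0.
  rewrite {1 2}vE -scalemxAr innerZl innerZr conjc_real.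
  rewrite 2!(mulrCA u) 2!fZ 2!normrM.
  rewrite (ger0_norm (vnorm_ge0 v)) mulrA -expr2 mulrC.
  by rewrite ler_wpM2r ?exprn_ge0 ?vnorm_ge0// fh.
have := cartesian_vnorm_le u1 (scale _ a (@ReZ R) _) (scale _ b (@ImZ R) _) x.
have uE v : u * inner (A *m v) v = ((cmod q)^-1)%:C%C * (q * inner (A *m v) v).
  by rewrite mulrA.
rewrite x1 mulr1; set S := _ + _ => SS.
apply: (@le_trans _ _ (2 * Num.sqrt (a ^+ 2 + b ^+ 2))).
  apply: SS => v v1; rewrite uE.
    apply: (le_trans (Re_le_cmod _)).
    rewrite Normc.normcM cmod_real ger0_norm ?invr_ge0 ?cmod_ge0//.
    by rewrite ler_wpM2l ?invr_ge0 ?cmod_ge0// numradius_le_qradius.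
  rewrite ImZ normrM ger0_norm ?invr_ge0 ?cmod_ge0//; apply: le_trans sb.
  rewrite /a mulrCA ler_wpM2l ?invr_ge0 ?cmod_ge0//.
  apply: (le_trans (sector_Im_le alpha_ge0 alpha_lt _)).
    exact: qsectorial_inner.
  by rewrite ler_wpM2l// numradius_le_qradius.
rewrite ler_pM2l// ler_wsqrtr// -addrA lerD//.
  by rewrite expr2; exact: (young_complementary psi_compl).
by rewrite expr2; exact: (young_complementary psi_compl).
Qed.
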